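(* The functors $\mathcal{M}at:\mathbf{CSRng}\to\mathbf{SMBLaw}$ and $\mathcal{H}:\mathbf{SMBLaw}\to\mathbf{CSRng}$ restrict to a pair of functors $\mathcal{M}at:\mathbf{ICSRng}\to\mathbf{DSMBLaw}$ and $\mathcal{H}:\mathbf{DSMBLaw}\to\mathbf{ICSRng}$. The restricted functors form an adjunction $\mathcal{M}at\dashv\mathcal{H}$.
   Context: $\mathbf{CSRng}$: commutative semirings in sets. $\mathbf{ICSRng}$: involutive commutative semirings, i.e. commutative semirings $S$ with a unary operation $*$ such that $(s+t)^*=s^*+t^*$, $0^*=0$, $(s\cdot t)^*=s^*\cdot t^*$, $1^*=1$, $(s^* )^*=s$; morphisms preserve all structure. Lawvere theories. Let $\underline{n}=\{0,\ldots,n-1\}$. $\aleph_0$ has natural numbers as objects and functions $\underline n\to\underline m$ as morphisms; $(+,0)$ gives finite coproducts. A Lawvere theory is a small category $\mathbf{L}$ with natural numbers as objects together with a functor $\aleph_0\to\mathbf{L}$ that is the identity on objects and strictly preserves finite coproducts; morphisms are identity-on-objects functors strictly preserving finite coproducts. $\aleph_0$ has a symmetric monoidal structure: $n\otimes m=n\times m$ (multiplication), unit $1$, $f\otimes g=\mathsf{co}^{-1}\circ(f\times g)\circ\mathsf{co}$ where $\mathsf{co}:\underline{n\times m}\to\underline n\times\underline m$ is the bijection with $\mathsf{co}(c)=(a,b)\iff c=a\cdot m+b$, and the monoidal isomorphisms are transported from $(\mathbf{Sets},\times,1)$ along $\mathsf{co}$. $\mathbf{SMBLaw}$: Lawvere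 theories $\mathbf{L}$ with a symmetric monoidal structure strictly preserved by $\aleph_0\to\mathbf{L}$, in which $(+,0)$ forms biproducts ($0$ is a zero object and each $n+m$ is also a product with projections satisfying $\pi_j\circ\kappa_i=\mathrm{id}$ if $i=j$, and the zero map if $i\ne j$). Morphisms are identity-on-objects functors strictly preserving all the structure. (The tensor then distributes over $(+,0)$.) $\mathbf{DSMBLaw}$: objects are $\mathbf{L}\in\mathbf{SMBLaw}$ equipped with a dagger, i.e. an identity-on-objects functor $\dagger:\mathbf{L}^{\mathrm{op}}\to\mathbf{L}$ with $(f^\dagger)^\dagger=f$, such that $(f\otimes g)^\dagger=f^\dagger\otimes g^\dagger$, the coherence isomorphisms $\alpha,\rho,\gamma$ of the symmetric monoidal structure are dagger isomorphisms (isomorphisms $f$ with $f^{-1}=f^\dagger$), and $\kappa_i=\pi_i^\dagger$. Morphisms are morphisms in $\mathbf{SMBLaw}$ strictly commuting with daggers. Functor $\mathcal{M}at$: morphisms $n\to m$ in $\mathcal{M}at(S)$ are functions $\underline n\times\underline m\to S$; identities are identity matrices; $(h\circ g)(i,k)=\sum_jg(i,j)\cdot h(j,k)$ for $g:n\to m$, $h:m\to p$; $\kappa_1:n\to n+m$ has $\kappa_1(i,j)=1$ if $i=j$ and $0$ otherwise; $\kappa_2:m\to n+m$ has $\kappa_2(i,j)=1$ if $j\geq n$ and $j-n=i$, and $0$ otherwise; projections are the transposed matrices; $(g\otimes h)((i_0,i_1),(j_0,j_1))=g(i_0,j_0)\cdot h(i_1,j_1)$ (pairs identified with numbers via $\mathsf{co}$).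 A semiring map $f$ acts by $h\mapsto f\circ h$. For $S$ involutive, $\mathcal{M}at(S)$ has dagger $f^\dagger(i,j)=f(j,i)^*$. Functor $\mathcal{H}$: $\mathcal{H}(\mathbf{L})=\mathbf{L}(1,1)$ with multiplication given by composition, unit $\mathrm{id}_1$, addition $f+g=[\mathrm{id},\mathrm{id}]\circ(f\oplus g)\circ\langle\mathrm{id},\mathrm{id}\rangle$, zero the zero map; a morphism $F$ is sent to its restriction. For $\mathbf{L}\in\mathbf{DSMBLaw}$ the involution is $s\mapsto s^\dagger$. *)

(* Defs.v *)
From HB Require Import structures.
From mathcomp Require Import all_boot all_order all_algebra.
From mathcomp Require Import boolp.
From mathcomp Require Import mxtens.

Set Implicit Arguments.
Unset Strict Implicit.
Unset Printing Implicit Defensive.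

Import GRing.Theory.

(* Category structures on a fixed type of objects. *)
Record catOn (O : Type) := CatOn {
  hom :> O -> O -> Type;
  idm : forall x, hom x x;
  mcomp : forall x y z, hom y z -> hom x y -> hom x z;
  mcomp_idl : forall x y (f : hom x y), mcomp (idm y) f = f;
  mcomp_idr : forall x y (f : hom x y), mcomp f (idm x) = f;
  mcompA : forall x y z t (h : hom z t) (g : hom y z) (f : hom x y),
    mcomp h (mcomp g f) = mcomp (mcomp h g) f }.

Arguments idm {O C} x : rename.
Arguments mcomp {O C x y z} g f : rename.
Arguments mcomp_idl {O C x y} f : rename.
Arguments mcomp_idr {O C x y} f : rename.
Arguments mcompA {O C x y z t} h g f : rename.

Reserved Notation "g \oc f" (at level 50, left associativity).
Notation "g \oc f" := (mcomp g f).

Definition is_inverse O (C : catOn O) x y (f : C x y) (g : C y x) : Prop :=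
  g \oc f = idm x /\ f \oc g = idm y.

Definition is_iso O (C : catOn O) x y (f : C x y) : Prop :=
  exists g : C y x, is_inverse f g.

Record ioFunctor O (C D : catOn O) := IoFunctor {
  iomap :> forall x y, C x y -> D x y;
  iomap_id : forall x, iomap (idm x) = idm x;
  iomap_comp : forall x y z (g : C y z) (f : C x y),
    iomap (g \oc f) = iomap g \oc iomap f }.

Arguments iomap {O C D} F {x y} f : rename.

Record category := Category { obj :> Type; obj_cat :> catOn obj }.

Record functor (C D : category) := Functor {
  fobj :> C -> D;
  fmap : forall x y : C, C x y -> D (fobj x) (fobj y);
  fmap_id : forall x : C, fmap (idm x) = idm (fobj x);
  fmap_comp : forall (x y z : C) (g : C y z) (f : C x y),
    fmap (g \oc f) = fmap g \oc fmap f }.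

Arguments fmap {C D} F {x y} f : rename.

Section FunctorComp.
Variables (C D E : category) (G : functor D E) (F : functor C D).

Lemma compF_id (x : C) : fmap G (fmap F (idm x)) = idm (G (F x)).
Proof. by rewrite !fmap_id. Qed.

Lemma compF_comp (x y z : C) (g : C y z) (f : C x y) :
  fmap G (fmap F (g \oc f)) = fmap G (fmap F g) \oc fmap G (fmap F f).
Proof. by rewrite !fmap_comp. Qed.

Definition compF : functor C E := @Functor C E (fun x => G (F x))
  (fun x y f => fmap G (fmap F f)) compF_id compF_comp.
End FunctorComp.

Definition adjunction (C D : category) (F : functor C D) (G : functor D C)
    : Prop :=
  exists phi : forall (x : C) (y : D), D (F x) y -> C x (G y),
    (forall x y, bijective (phi x y)) /\
    (forall (x x' : C) (y y' : D) (f : C x' x) (h : D y y') (k : D (F x) y),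
       phi x' y' (h \oc k \oc fmap F f) = fmap G h \oc phi x y k \oc f).

(* Chosen finite coproducts with [n + m] as coproduct and [0] as initial
   object. *)
Record coproducts (C : catOn nat) := Coproducts {
  kap1 : forall n m, C n (n + m);
  kap2 : forall n m, C m (n + m);
  copairing : forall n m p, C n p -> C m p -> C (n + m) p;
  copairing_kap1 : forall n m p (f : C n p) (g : C m p),
    copairing f g \oc kap1 n m = f;
  copairing_kap2 : forall n m p (f : C n p) (g : C m p),
    copairing f g \oc kap2 n m = g;
  copairing_eta : forall n m p (h : C (n + m) p),
    copairing (h \oc kap1 n m) (h \oc kap2 n m) = h;
  from0 : forall n, C 0 n;
  from0_eta : forall n (f : C 0 n), f = from0 n }.

Record products (C : catOn nat) := Products {
  prj1 : forall n m, C (n + m) n;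
  prj2 : forall n m, C (n + m) m;
  pairing : forall n m p, C p n -> C p m -> C p (n + m);
  prj1_pairing : forall n m p (f : C p n) (g : C p m),
    prj1 n m \oc pairing f g = f;
  prj2_pairing : forall n m p (f : C p n) (g : C p m),
    prj2 n m \oc pairing f g = g;
  pairing_eta : forall n m p (h : C p (n + m)),
    pairing (prj1 n m \oc h) (prj2 n m \oc h) = h;
  to0 : forall n, C n 0;
  to0_eta : forall n (f : C n 0), f = to0 n }.

(* Symmetric monoidal structures with [n * m] as tensor and [1] as unit. *)
Record symmon (C : catOn nat) := Symmon {
  tens : forall n m p q, C n m -> C p q -> C (n * p) (m * q);
  alpha : forall n m p, C (n * m * p) (n * (m * p));
  lam : forall n, C (1 * n) n;
  rho : forall n, C (n * 1) n;
  gam : forall n m, C (n * m) (m * n);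
  tens_id : forall n m, tens (idm n) (idm m) = idm (n * m);
  tens_comp : forall n m p n' m' p'
      (g : C m p) (f : C n m) (g' : C m' p') (f' : C n' m'),
    tens (g \oc f) (g' \oc f') = tens g g' \oc tens f f';
  alpha_iso : forall n m p, is_iso (alpha n m p);
  lam_iso : forall n, is_iso (lam n);
  rho_iso : forall n, is_iso (rho n);
  alpha_nat : forall n n' m m' p p' (f : C n n') (g : C m m') (h : C p p'),
    alpha n' m' p' \oc tens (tens f g) h
    = tens f (tens g h) \oc alpha n m p;
  lam_nat : forall n m (f : C n m), lam m \oc tens (idm 1) f = f \oc lam n;
  rho_nat : forall n m (f : C n m), rho m \oc tens f (idm 1) = f \oc rho n;
  gam_nat : forall n n' m m' (f : C n n') (g : C m m'),
    gam n' m' \oc tens f g = tens g f \oc gam n m;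
  pentagon : forall n m p q,
    alpha n m (p * q) \oc alpha (n * m) p q
    = tens (idm n) (alpha m p q) \oc alpha n (m * p) q
      \oc tens (alpha n m p) (idm q);
  triangle : forall n m,
    tens (idm n) (lam m) \oc alpha n 1 m = tens (rho n) (idm m);
  gam_gam : forall n m, gam m n \oc gam n m = idm (n * m);
  lam_gam : forall n, lam n \oc gam n 1 = rho n;
  hexagon : forall n m p,
    alpha m p n \oc gam n (m * p) \oc alpha n m p
    = tens (idm m) (gam n p) \oc alpha m n p
      \oc tens (gam n m) (idm p) }.

(* Cotuples and maps out of [0] are then preserved too, by uniqueness. *)
Definition strict_coproducts (C D : catOn nat)
    (kC : coproducts C) (kD : coproducts D) (F : ioFunctor C D) : Prop :=
  (forall n m, F _ _ (kap1 kC n m) = kap1 kD n m) /\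
  (forall n m, F _ _ (kap2 kC n m) = kap2 kD n m).

Definition strict_products (C D : catOn nat)
    (pC : products C) (pD : products D) (F : ioFunctor C D) : Prop :=
  (forall n m, F _ _ (prj1 pC n m) = prj1 pD n m) /\
  (forall n m, F _ _ (prj2 pC n m) = prj2 pD n m).

Record strict_symmon (C D : catOn nat) (mC : symmon C) (mD : symmon D)
    (F : ioFunctor C D) : Prop := StrictSymmon {
  strict_tens : forall n m p q (f : C n m) (g : C p q),
    F _ _ (tens mC f g) = tens mD (F _ _ f) (F _ _ g);
  strict_alpha : forall n m p, F _ _ (alpha mC n m p) = alpha mD n m p;
  strict_lam : forall n, F _ _ (lam mC n) = lam mD n;
  strict_rho : forall n, F _ _ (rho mC n) = rho mD n;
  strict_gam : forall n m, F _ _ (gam mC n m) = gam mD n m }.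

Definition aleph0 : catOn nat :=
  @CatOn nat (fun n m => 'I_n -> 'I_m) (fun n i => i)
    (fun n m p g f i => g (f i))
    (fun _ _ _ => erefl) (fun _ _ _ => erefl) (fun _ _ _ _ _ _ _ => erefl).

Definition fcopair n m p (f : 'I_n -> 'I_p) (g : 'I_m -> 'I_p) :
    'I_(n + m) -> 'I_p :=
  fun i => match split i with inl j => f j | inr k => g k end.

Lemma fcopairl n m p (f : 'I_n -> 'I_p) (g : 'I_m -> 'I_p) :
  (fun i => fcopair f g (lshift m i)) = f.
Proof.
by apply/funext => i; rewrite /fcopair -[lshift m i]/(unsplit (inl i)) unsplitK.
Qed.

Lemma fcopairr n m p (f : 'I_n -> 'I_p) (g : 'I_m -> 'I_p) :
  (fun i => fcopair f g (rshift n i)) = g.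
Proof.
by apply/funext => i; rewrite /fcopair -[rshift n i]/(unsplit (inr i)) unsplitK.
Qed.

Lemma fcopair_eta n m p (h : 'I_(n + m) -> 'I_p) :
  fcopair (fun i => h (lshift m i)) (fun i => h (rshift n i)) = h.
Proof.
apply/funext => i; rewrite -[in RHS](splitK i) /fcopair.
by case: (split i).
Qed.

Definition finit n : 'I_0 -> 'I_n := fun i => False_rect _ (notF (valP i)).

Lemma finit_eta n (f : 'I_0 -> 'I_n) : f = finit n.
Proof. by apply/funext => -[]. Qed.

Definition aleph0_coproducts : coproducts aleph0 :=
  @Coproducts aleph0 (fun n m => @lshift n m) (fun n m => @rshift n m)
    fcopair fcopairl fcopairr fcopair_eta finit finit_eta.

(* [co (a * m + b) = (a, b)], with inverse [coV]. *)
Definition co {n m} (c : 'I_(n * m)) : 'I_n * 'I_m := mxtens_unindex c.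
Definition coV {n m} (p : 'I_n * 'I_m) : 'I_(n * m) := mxtens_index p.

Lemma coK n m : cancel (@co n m) coV.
Proof. exact: mxtens_unindexK. Qed.

Lemma coVK n m : cancel (@coV n m) co.
Proof. exact: mxtens_indexK. Qed.

#[local] Opaque co coV.

Definition ftens n m p q (f : 'I_n -> 'I_m) (g : 'I_p -> 'I_q) :
    'I_(n * p) -> 'I_(m * q) :=
  fun c => coV (f (co c).1, g (co c).2).

Definition falpha n m p : 'I_(n * m * p) -> 'I_(n * (m * p)) :=
  fun c => coV ((co (co c).1).1, coV ((co (co c).1).2, (co c).2)).

Definition falphaV n m p : 'I_(n * (m * p)) -> 'I_(n * m * p) :=
  fun c => coV (coV ((co c).1, (co (co c).2).1), (co (co c).2).2).

Definition flam n : 'I_(1 * n) -> 'I_n := fun c => (co c).2.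
Definition flamV n : 'I_n -> 'I_(1 * n) := fun i => coV (ord0, i).
Definition frho n : 'I_(n * 1) -> 'I_n := fun c => (co c).1.
Definition frhoV n : 'I_n -> 'I_(n * 1) := fun i => coV (i, ord0).
Definition fgam n m : 'I_(n * m) -> 'I_(m * n) :=
  fun c => coV ((co c).2, (co c).1).

Lemma falphaK n m p : cancel (@falpha n m p) (@falphaV n m p).
Proof. by move=> c; rewrite /falphaV /falpha !coVK /= -surjective_pairing
  coK -surjective_pairing coK. Qed.

Lemma falphaVK n m p : cancel (@falphaV n m p) (@falpha n m p).
Proof. by move=> c; rewrite /falphaV /falpha !coVK /= -surjective_pairing
  coK -surjective_pairing coK. Qed.

Lemma flamK n : cancel (@flam n) (@flamV n).
Proof.
move=> c; rewrite /flamV /flam -[RHS]coK; congr coV.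
by rewrite [RHS]surjective_pairing (ord1 (co c).1).
Qed.

Lemma flamVK n : cancel (@flamV n) (@flam n).
Proof. by move=> c; rewrite /flamV /flam coVK. Qed.

Lemma frhoK n : cancel (@frho n) (@frhoV n).
Proof.
move=> c; rewrite /frhoV /frho -[RHS]coK; congr coV.
by rewrite [RHS]surjective_pairing (ord1 (co c).2).
Qed.

Lemma frhoVK n : cancel (@frhoV n) (@frho n).
Proof. by move=> c; rewrite /frhoV /frho coVK. Qed.

Lemma fgamK n m : cancel (@fgam n m) (@fgam m n).
Proof. by move=> c; rewrite /fgam coVK /= -surjective_pairing coK. Qed.

Lemma aleph0_iso n m (f : 'I_n -> 'I_m) (g : 'I_m -> 'I_n) :
  cancel f g -> cancel g f -> @is_inverse nat aleph0 n m f g.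
Proof. by move=> fK gK; split; apply/funext. Qed.

Definition aleph0_symmon : symmon aleph0.
Proof.
apply: (@Symmon aleph0 ftens falpha flam frho fgam) => /=.
- by move=> n m; apply/funext => c; rewrite /ftens -surjective_pairing coK.
- by move=> *; apply/funext => c; rewrite /ftens /= coVK.
- by move=> n m p; exists (@falphaV n m p);
    apply: aleph0_iso; [exact: falphaK|exact: falphaVK].
- by move=> n; exists (@flamV n);
    apply: aleph0_iso; [exact: flamK|exact: flamVK].
- by move=> n; exists (@frhoV n);
    apply: aleph0_iso; [exact: frhoK|exact: frhoVK].
- move=> *; apply/funext => c; rewrite /falpha /ftens.
  by do ?rewrite coVK /=.
- move=> *; apply/funext => c; rewrite /flam /ftens.
  by do ?rewrite coVK /=.
- move=> *; apply/funext => c; rewrite /frho /ftens.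
  by do ?rewrite coVK /=.
- move=> *; apply/funext => c; rewrite /fgam /ftens.
  by do ?rewrite coVK /=.
- move=> *; apply/funext => c; rewrite /falpha /ftens.
  by do ?rewrite coVK /=.
- move=> *; apply/funext => c; rewrite /falpha /flam /frho /ftens.
  by do ?rewrite coVK /=.
- by move=> *; apply/funext => c; rewrite fgamK.
- by move=> *; apply/funext => c; rewrite /flam /fgam /frho coVK.
- move=> *; apply/funext => c; rewrite /falpha /fgam /ftens.
  by do ?rewrite coVK /=.
Defined.

Record lawvere := Lawvere {
  law_cat :> catOn nat;
  law_coprod : coproducts law_cat;
  law_inc : ioFunctor aleph0 law_cat;
  law_inc_coprod : strict_coproducts aleph0_coproducts law_coprod law_inc }.

Definition zeromap (C : catOn nat) (kC : coproducts C) (pC : products C) n m :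
  C n m := from0 kC m \oc to0 pC n.

Record biproducts (C : catOn nat) (kC : coproducts C) (pC : products C) :
    Prop := Biproducts {
  prj1_kap1 : forall n m, prj1 pC n m \oc kap1 kC n m = idm n;
  prj2_kap2 : forall n m, prj2 pC n m \oc kap2 kC n m = idm m;
  prj2_kap1 : forall n m,
    prj2 pC n m \oc kap1 kC n m = zeromap kC pC n m;
  prj1_kap2 : forall n m,
    prj1 pC n m \oc kap2 kC n m = zeromap kC pC m n }.

Record smbLaw := SmbLaw {
  smb_law :> lawvere;
  smb_mon : symmon smb_law;
  smb_mon_strict : strict_symmon aleph0_symmon smb_mon (law_inc smb_law);
  smb_prod : products smb_law;
  smb_biprod : biproducts (law_coprod smb_law) smb_prod }.

Record smbHom (L K : smbLaw) := SmbHom {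
  smb_fun :> ioFunctor L K;
  smb_fun_coprod : strict_coproducts (law_coprod L) (law_coprod K) smb_fun;
  smb_fun_prod : strict_products (smb_prod L) (smb_prod K) smb_fun;
  smb_fun_mon : strict_symmon (smb_mon L) (smb_mon K) smb_fun }.

Lemma ioFunctorP O (C D : catOn O) (F G : ioFunctor C D) :
  (forall x y (f : C x y), F _ _ f = G _ _ f) -> F = G.
Proof.
case: F G => [F F1 F2] [G G1 G2] /= FG.
have {}FG : F = G.
  by apply: functional_extensionality_dep => x;
     apply: functional_extensionality_dep => y; apply/funext => f.
by case: G / FG G1 G2 => G1 G2; congr IoFunctor; exact: Prop_irrelevance.
Qed.

Lemma smbHomP (L K : smbLaw) (F G : smbHom L K) :
  (forall n m (f : L n m), F _ _ f = G _ _ f) -> F = G.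
Proof.
case: F G => [F F1 F2 F3] [G G1 G2 G3] /= /ioFunctorP FG.
by case: G / FG G1 G2 G3 => *; congr SmbHom; exact: Prop_irrelevance.
Qed.

Section IoFunctorComp.
Variables (O : Type) (C D E : catOn O).

Definition ioId : ioFunctor C C :=
  @IoFunctor O C C (fun _ _ f => f) (fun _ => erefl) (fun _ _ _ _ _ => erefl).

Variables (G : ioFunctor D E) (F : ioFunctor C D).

Lemma ioComp_id x : G x x (F x x (idm x)) = idm x.
Proof. by rewrite !iomap_id. Qed.

Lemma ioComp_comp x y z (g : C y z) (f : C x y) :
  G _ _ (F _ _ (g \oc f)) = G _ _ (F _ _ g) \oc G _ _ (F _ _ f).
Proof. by rewrite !iomap_comp. Qed.

Definition ioComp : ioFunctor C E :=
  @IoFunctor O C E (fun _ _ f => G _ _ (F _ _ f)) ioComp_id ioComp_comp.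
End IoFunctorComp.

Definition smbId (L : smbLaw) : smbHom L L.
Proof. by apply: (@SmbHom _ _ (ioId L)); split. Defined.

Section SmbComp.
Variables (L K M : smbLaw) (G : smbHom K M) (F : smbHom L K).

Lemma smbComp_coprod :
  strict_coproducts (law_coprod L) (law_coprod M) (ioComp G F).
Proof.
case: (smb_fun_coprod G) (smb_fun_coprod F) => [G1 G2] [F1 F2].
by split=> n m /=; rewrite (F1, F2) (G1, G2).
Qed.

Lemma smbComp_prod : strict_products (smb_prod L) (smb_prod M) (ioComp G F).
Proof.
case: (smb_fun_prod G) (smb_fun_prod F) => [G1 G2] [F1 F2].
by split=> n m /=; rewrite (F1, F2) (G1, G2).
Qed.

Lemma smbComp_mon : strict_symmon (smb_mon L) (smb_mon M) (ioComp G F).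
Proof.
case: (smb_fun_mon G) (smb_fun_mon F) => [G1 G2 G3 G4 G5] [F1 F2 F3 F4 F5].
by split=> *; rewrite /= (F1, F2, F3, F4, F5) (G1, G2, G3, G4, G5).
Qed.

Definition smbComp : smbHom L M :=
  SmbHom smbComp_coprod smbComp_prod smbComp_mon.
End SmbComp.

Definition SMBLaw : category.
Proof.
apply: (@Category smbLaw (@CatOn smbLaw smbHom smbId
  (fun L K M G F => smbComp G F) _ _ _)) => *; exact: smbHomP.
Defined.

Lemma rmorphismP (S T : comPzSemiRingType) (f g : {rmorphism S -> T}) :
  f =1 g -> f = g.
Proof.
case: f g => [f cf] [g cg] /= /funext fg.
case: g / fg cg => cg; congr GRing.RMorphism.Pack.
case: cf cg => [[a] [b]] [[a'] [b']].
by rewrite (Prop_irrelevance a a') (Prop_irrelevance b b').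
Qed.

(* Commutative semirings, the trivial one included. *)
Definition CSRng : category.
Proof.
apply: (@Category comPzSemiRingType (@CatOn comPzSemiRingType
  (fun S T => {rmorphism S -> T}) (fun S => [the {rmorphism S -> S} of idfun])
  (fun S T U g f => [the {rmorphism S -> U} of g \o f]) _ _ _)) => *;
  exact: rmorphismP.
Defined.

Local Open Scope ring_scope.

Record is_involution (S : comPzSemiRingType) (star : S -> S) : Prop :=
  IsInvolution {
    starD : forall s t, star (s + t) = star s + star t;
    star0 : star 0 = 0;
    starM : forall s t, star (s * t) = star s * star t;
    star1 : star 1 = 1;
    starK : forall s, star (star s) = s }.

Record icsRing := IcsRing {
  ics_ring :> comPzSemiRingType;
  star : ics_ring -> ics_ring;
  star_involution : is_involution star }.

Arguments star {S} s : rename.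

Record icsHom (S T : icsRing) := IcsHom {
  ics_fun :> {rmorphism S -> T};
  ics_fun_star : forall s, ics_fun (star s) = star (ics_fun s) }.

Lemma icsHomP (S T : icsRing) (f g : icsHom S T) : f =1 g -> f = g.
Proof.
case: f g => [f f1] [g g1] /= /rmorphismP fg.
by case: g / fg g1 => g1; congr IcsHom; exact: Prop_irrelevance.
Qed.

Definition icsId (S : icsRing) : icsHom S S :=
  @IcsHom S S [the {rmorphism S -> S} of idfun] (fun _ => erefl).

Lemma icsComp_star (S T U : icsRing) (g : icsHom T U) (f : icsHom S T) s :
  g (f (star s)) = star (g (f s)).
Proof. by rewrite !ics_fun_star. Qed.

Definition icsComp (S T U : icsRing) (g : icsHom T U) (f : icsHom S T) :
    icsHom S U :=
  @IcsHom S U [the {rmorphism S -> U} of g \o f] (icsComp_star g f).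

Definition ICSRng : category.
Proof.
apply: (@Category icsRing (@CatOn icsRing icsHom icsId
  (fun S T U g f => icsComp g f) _ _ _)) => *; exact: icsHomP.
Defined.

Definition forget_star : functor ICSRng CSRng :=
  @Functor ICSRng CSRng ics_ring (fun S T f => ics_fun f)
    (fun _ => erefl) (fun _ _ _ _ _ => erefl).

Definition is_dagger_iso (L : smbLaw) (dag : forall n m, L n m -> L m n)
    n m (f : L n m) : Prop := is_inverse f (dag n m f).

Record is_dagger (L : smbLaw) (dag : forall n m, L n m -> L m n) : Prop :=
  IsDagger {
    dag_id : forall n, dag n n (idm n) = idm n;
    dag_comp : forall n m p (g : L m p) (f : L n m),
      dag _ _ (g \oc f) = dag _ _ f \oc dag _ _ g;
    dagK : forall n m (f : L n m), dag _ _ (dag _ _ f) = f;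
    dag_tens : forall n m p q (f : L n m) (g : L p q),
      dag _ _ (tens (smb_mon L) f g)
      = tens (smb_mon L) (dag _ _ f) (dag _ _ g);
    (* The left unitor is [rho] composed with [gam], so it is covered as well. *)
    dag_alpha : forall n m p, is_dagger_iso dag (alpha (smb_mon L) n m p);
    dag_rho : forall n, is_dagger_iso dag (rho (smb_mon L) n);
    dag_gam : forall n m, is_dagger_iso dag (gam (smb_mon L) n m);
    dag_prj1 : forall n m,
      kap1 (law_coprod L) n m = dag _ _ (prj1 (smb_prod L) n m);
    dag_prj2 : forall n m,
      kap2 (law_coprod L) n m = dag _ _ (prj2 (smb_prod L) n m) }.

Record dsmbLaw := DsmbLaw {
  dsmb_law :> smbLaw;
  dag : forall n m, dsmb_law n m -> dsmb_law m n;
  dag_dagger : is_dagger dag }.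

Arguments dag {L n m} f : rename.

Record dsmbHom (L K : dsmbLaw) := DsmbHom {
  dsmb_fun :> smbHom L K;
  dsmb_fun_dag : forall n m (f : L n m),
    dsmb_fun _ _ (dag f) = dag (dsmb_fun _ _ f) }.

Lemma dsmbHomP (L K : dsmbLaw) (F G : dsmbHom L K) :
  (forall n m (f : L n m), F _ _ f = G _ _ f) -> F = G.
Proof.
case: F G => [F F1] [G G1] /= /smbHomP FG.
by case: G / FG G1 => G1; congr DsmbHom; exact: Prop_irrelevance.
Qed.

Definition dsmbId (L : dsmbLaw) : dsmbHom L L :=
  @DsmbHom L L (smbId L) (fun _ _ _ => erefl).

Lemma dsmbComp_dag (L K M : dsmbLaw) (G : dsmbHom K M) (F : dsmbHom L K)
    n m (f : L n m) :
  smbComp G F _ _ (dag f) = dag (smbComp G F _ _ f).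
Proof. by rewrite /= !dsmb_fun_dag. Qed.

Definition dsmbComp (L K M : dsmbLaw) (G : dsmbHom K M) (F : dsmbHom L K) :
  dsmbHom L M := DsmbHom (dsmbComp_dag G F).

Definition DSMBLaw : category.
Proof.
apply: (@Category dsmbLaw (@CatOn dsmbLaw dsmbHom dsmbId
  (fun L K M G F => dsmbComp G F) _ _ _)) => *; exact: dsmbHomP.
Defined.

Definition forget_dag : functor DSMBLaw SMBLaw :=
  @Functor DSMBLaw SMBLaw dsmb_law (fun L K F => dsmb_fun F)
    (fun _ => erefl) (fun _ _ _ _ _ => erefl).

Section Mat.
Variable S : comPzSemiRingType.

Definition mat_cat : catOn nat :=
  @CatOn nat (fun n m => 'M[S]_(n, m)) (fun n => 1%:M)
    (fun n m p h g => g *m h)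
    (fun n m f => mulmx1 f) (fun n m f => mul1mx f)
    (fun n m p q h g f => esym (mulmxA f g h)).

Definition mat_kap1 n m : 'M[S]_(n, n + m) := row_mx 1%:M 0.
Definition mat_kap2 n m : 'M[S]_(m, n + m) := row_mx 0 1%:M.
Definition mat_prj1 n m : 'M[S]_(n + m, n) := (mat_kap1 n m)^T.
Definition mat_prj2 n m : 'M[S]_(n + m, m) := (mat_kap2 n m)^T.

Lemma mat_prj1E n m : mat_prj1 n m = col_mx 1%:M 0.
Proof. by rewrite /mat_prj1 tr_row_mx trmx1 trmx0. Qed.

Lemma mat_prj2E n m : mat_prj2 n m = col_mx 0 1%:M.
Proof. by rewrite /mat_prj2 tr_row_mx trmx1 trmx0. Qed.

Definition mat_coproducts : coproducts mat_cat.
Proof.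
apply: (@Coproducts mat_cat mat_kap1 mat_kap2 (fun n m p => @col_mx S n m p)
  _ _ _ (fun n => 0)) => /=.
- by move=> n m p f g; rewrite mul_row_col mul1mx mul0mx addr0.
- by move=> n m p f g; rewrite mul_row_col mul1mx mul0mx add0r.
- move=> n m p h; rewrite -[h]vsubmxK !mul_row_col.
  by rewrite !mul1mx !mul0mx addr0 add0r.
- by move=> n f; apply/matrixP => -[].
Defined.

Definition mat_products : products mat_cat.
Proof.
apply: (@Products mat_cat mat_prj1 mat_prj2 (fun n m p => @row_mx S p n m)
  _ _ _ (fun n => 0)) => /=.
- by move=> n m p f g; rewrite mat_prj1E mul_row_col mulmx1 mulmx0 addr0.
- by move=> n m p f g; rewrite mat_prj2E mul_row_col mulmx1 mulmx0 add0r.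
- move=> n m p h; rewrite mat_prj1E mat_prj2E -[h]hsubmxK !mul_row_col.
  by rewrite !mulmx1 !mulmx0 addr0 add0r.
- by move=> n f; apply/matrixP => i -[].
Defined.

(* Determined by [mat_kap1] and [mat_kap2], since the inclusion of [aleph0] has
   to preserve coprojections strictly. *)
Definition mat_fun n m (f : 'I_n -> 'I_m) : 'M[S]_(n, m) :=
  \matrix_(i, j) (f i == j)%:R.

Lemma mul_mat_fun n m p (f : 'I_n -> 'I_m) (A : 'M[S]_(m, p)) :
  mat_fun f *m A = \matrix_(i, j) A (f i) j.
Proof.
apply/matrixP => i j; rewrite !mxE (bigD1 (f i)) //= mxE eqxx mul1r.
by rewrite big1 ?addr0 // => k /negPf kf; rewrite mxE eq_sym kf mul0r.
Qed.

Lemma mul_fun_mat n m p (f : 'I_m -> 'I_p) (g : 'I_p -> 'I_m)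
    (A : 'M[S]_(n, m)) : cancel f g -> cancel g f ->
  A *m mat_fun f = \matrix_(i, j) A i (g j).
Proof.
move=> fK gK; apply/matrixP => i j.
rewrite !mxE (bigD1 (g j)) //= mxE gK eqxx mulr1.
rewrite big1 ?addr0 // => k; rewrite mxE => kg.
by rewrite (can2_eq fK gK) (negPf kg) mulr0.
Qed.

Lemma mat_fun_id n : mat_fun (fun i : 'I_n => i) = 1%:M.
Proof. by apply/matrixP => i j; rewrite !mxE. Qed.

Lemma mat_fun_comp n m p (g : 'I_m -> 'I_p) (f : 'I_n -> 'I_m) :
  mat_fun (fun i => g (f i)) = mat_fun f *m mat_fun g.
Proof. by rewrite mul_mat_fun; apply/matrixP => i j; rewrite !mxE. Qed.

Definition mat_inc : ioFunctor aleph0 mat_cat :=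
  @IoFunctor nat aleph0 mat_cat mat_fun mat_fun_id mat_fun_comp.

Lemma mat_inc_coprod :
  strict_coproducts aleph0_coproducts mat_coproducts mat_inc.
Proof.
split=> n m; apply/matrixP => i j; rewrite !mxE /=;
  case: splitP => k jk; rewrite mxE -val_eqE /= jk //.
- by rewrite ltn_eqF // ltn_addr.
- by rewrite gtn_eqF // ltn_addr.
- by rewrite eqn_add2l.
Qed.

Definition mat_lawvere : lawvere := Lawvere mat_inc_coprod.

Definition mat_tens n m p q (A : 'M[S]_(n, m)) (B : 'M[S]_(p, q)) :
    'M[S]_(n * p, m * q) :=
  \matrix_(c, d) (A (co c).1 (co d).1 * B (co c).2 (co d).2).

Lemma mat_tens_id n m : mat_tens 1%:M 1%:M = 1%:M :> 'M_(n * m).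
Proof.
apply/matrixP => c d; rewrite !mxE -natrM mulnb -xpair_eqE.
by rewrite -!surjective_pairing (can_eq (@coK n m)).
Qed.

Lemma mat_tens_comp n m p n' m' p'
    (B : 'M[S]_(m, p)) (A : 'M_(n, m)) (B' : 'M_(m', p')) (A' : 'M_(n', m')) :
  mat_tens (A *m B) (A' *m B') = mat_tens A A' *m mat_tens B B'.
Proof.
apply/matrixP => c d; rewrite !mxE mulr_suml.
under eq_bigr do rewrite mulr_sumr.
rewrite pair_big /= (reindex (@co m m')) /=; last first.
  by exists (@coV m m') => k _; rewrite ?coK ?coVK.
by apply: eq_bigr => k _; rewrite !mxE mulrACA.
Qed.

Lemma mat_fun_tens n m p q (f : 'I_n -> 'I_m) (g : 'I_p -> 'I_q) :
  mat_fun (ftens f g) = mat_tens (mat_fun f) (mat_fun g).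
Proof.
apply/matrixP => c d; rewrite !mxE -natrM mulnb -xpair_eqE.
by rewrite -surjective_pairing -(can_eq (@coVK m q)) coK.
Qed.

Lemma mat_fun_iso n m (f : 'I_n -> 'I_m) :
  @is_iso _ aleph0 _ _ f -> @is_iso _ mat_cat _ _ (mat_fun f).
Proof.
move=> [g [fg gf]]; exists (mat_fun g); split => /=.
  by rewrite -mat_fun_comp [X in mat_fun X]fg mat_fun_id.
by rewrite -mat_fun_comp [X in mat_fun X]gf mat_fun_id.
Qed.

Definition mat_symmon : symmon mat_cat.
Proof.
apply: (@Symmon mat_cat mat_tens
  (fun n m p => mat_fun (@falpha n m p)) (fun n => mat_fun (@flam n))
  (fun n => mat_fun (@frho n)) (fun n m => mat_fun (@fgam n m))) => /=.
- exact: mat_tens_id.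
- by move=> *; rewrite mat_tens_comp.
- by move=> n m p; apply: mat_fun_iso; exact: (alpha_iso aleph0_symmon).
- by move=> n; apply: mat_fun_iso; exact: (lam_iso aleph0_symmon).
- by move=> n; apply: mat_fun_iso; exact: (rho_iso aleph0_symmon).
- move=> n n' m m' p p' f g h.
  rewrite mul_mat_fun (mul_fun_mat _ (@falphaK _ _ _) (@falphaVK _ _ _)).
  apply/matrixP => c d; rewrite !mxE /falpha /falphaV.
  by do ?rewrite coVK /=; rewrite mulrA.
- move=> n m f; rewrite mul_mat_fun (mul_fun_mat _ (@flamK _) (@flamVK _)).
  apply/matrixP => c d; rewrite !mxE /flam /flamV coVK /=.
  by rewrite (ord1 (co c).1) eqxx mul1r.
- move=> n m f; rewrite mul_mat_fun (mul_fun_mat _ (@frhoK _) (@frhoVK _)).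
  apply/matrixP => c d; rewrite !mxE /frho /frhoV coVK /=.
  by rewrite (ord1 (co c).2) eqxx mulr1.
- move=> n n' m m' f g.
  rewrite mul_mat_fun (mul_fun_mat _ (@fgamK _ _) (@fgamK _ _)).
  by apply/matrixP => c d; rewrite !mxE /fgam !coVK /= mulrC.
- move=> n m p q; rewrite -!mat_fun_id -!mat_fun_tens -!mat_fun_comp.
  by congr mat_fun; exact: (pentagon aleph0_symmon).
- move=> n m; rewrite -!mat_fun_id -!mat_fun_tens -!mat_fun_comp.
  by congr mat_fun; exact: (triangle aleph0_symmon).
- move=> n m; rewrite -!mat_fun_id -!mat_fun_comp.
  by congr mat_fun; exact: (gam_gam aleph0_symmon).
- move=> n; rewrite -!mat_fun_comp.
  by congr mat_fun; exact: (lam_gam aleph0_symmon).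
- move=> n m p; rewrite -!mat_fun_id -!mat_fun_tens -!mat_fun_comp.
  by congr mat_fun; exact: (hexagon aleph0_symmon).
Defined.

Lemma mat_symmon_strict : strict_symmon aleph0_symmon mat_symmon mat_inc.
Proof. by split=> //= *; exact: mat_fun_tens. Qed.

Lemma mat_biprod : biproducts mat_coproducts mat_products.
Proof.
split=> n m; rewrite /= /zeromap /= ?mat_prj1E ?mat_prj2E mul_row_col;
  by rewrite ?mul1mx ?mul0mx ?addr0 ?add0r ?mulmx0 ?mulmx1.
Qed.

Definition mat_law : smbLaw := @SmbLaw mat_lawvere mat_symmon
  mat_symmon_strict mat_products mat_biprod.

End Mat.

Section MatMap.
Variables (S T : comPzSemiRingType) (f : {rmorphism S -> T}).

Lemma mat_map_id n : map_mx f 1%:M = 1%:M :> 'M_n.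
Proof. exact: map_mx1. Qed.

Lemma mat_map_comp n m p (B : 'M_(m, p)) (A : 'M_(n, m)) :
  map_mx f (A *m B) = map_mx f A *m map_mx f B.
Proof. exact: map_mxM. Qed.

Definition mat_map : ioFunctor (mat_cat S) (mat_cat T) :=
  @IoFunctor nat (mat_cat S) (mat_cat T) (fun n m A => map_mx f A)
    mat_map_id mat_map_comp.

Lemma mat_map_fun n m (g : 'I_n -> 'I_m) :
  map_mx f (mat_fun S g) = mat_fun T g.
Proof. by apply/matrixP => i j; rewrite !mxE rmorph_nat. Qed.

Lemma mat_map_coprod :
  strict_coproducts (mat_coproducts S) (mat_coproducts T) mat_map.
Proof. by split=> n m /=; rewrite map_row_mx map_mx1 map_mx0. Qed.

Lemma mat_map_prod :
  strict_products (mat_products S) (mat_products T) mat_map.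
Proof.
by split=> n m /=; rewrite ?mat_prj1E ?mat_prj2E map_col_mx map_mx1 map_mx0.
Qed.

Lemma mat_map_mon : strict_symmon (mat_symmon S) (mat_symmon T) mat_map.
Proof.
split=> * /=; rewrite ?mat_map_fun //.
by apply/matrixP => c d; rewrite !mxE rmorphM.
Qed.

Definition mat_hom : smbHom (mat_law S) (mat_law T) :=
  @SmbHom (mat_law S) (mat_law T) mat_map
    mat_map_coprod mat_map_prod mat_map_mon.
End MatMap.

Definition Mat : functor CSRng SMBLaw.
Proof.
apply: (@Functor CSRng SMBLaw mat_law mat_hom).
- by move=> S; apply: smbHomP => n m A; apply/matrixP => i j; rewrite mxE.
- by move=> S T U g f; apply: smbHomP => n m A; apply/matrixP => i j; rewrite !mxE.
Defined.

Definition mat_dag (S : icsRing) n m (A : mat_law S n m) : mat_law S m n :=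
  map_mx star A^T.

Definition oplus (L : smbLaw) n m p q (f : L n m) (g : L p q) :
    L (n + p)%N (m + q)%N :=
  copairing (law_coprod L) (kap1 (law_coprod L) m q \oc f)
                           (kap2 (law_coprod L) m q \oc g).

Section Scalars.
Variable L : smbLaw.
Local Notation kC := (law_coprod L).
Local Notation pC := (smb_prod L).
Local Notation mC := (smb_mon L).

Definition diag n : L n (n + n)%N := pairing pC (idm n) (idm n).
Definition codiag n : L (n + n)%N n := copairing kC (idm n) (idm n).

Definition hadd n m (f g : L n m) : L n m :=
  codiag m \oc oplus f g \oc diag n.

Definition hzero n m : L n m := zeromap kC pC n m.

Lemma copairing_comp n m p q (h : L p q) (f : L n p) (g : L m p) :
  h \oc copairing kC f g = copairing kC (h \oc f) (h \oc g).
Proof.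
by rewrite -[LHS](copairing_eta kC) -!mcompA copairing_kap1 copairing_kap2.
Qed.

Lemma pairing_comp n m p q (h : L q p) (f : L p n) (g : L p m) :
  pairing pC f g \oc h = pairing pC (f \oc h) (g \oc h).
Proof.
by rewrite -[LHS](pairing_eta pC) !mcompA prj1_pairing prj2_pairing.
Qed.

Lemma hzero_compl n m p (f : L n m) : hzero m p \oc f = hzero n p.
Proof.
by rewrite /hzero /zeromap -mcompA [to0 _ _ \oc _](to0_eta pC).
Qed.

Lemma hzero_compr n m p (f : L m p) : f \oc hzero n m = hzero n p.
Proof.
by rewrite /hzero /zeromap mcompA [_ \oc from0 _ _](from0_eta kC).
Qed.

Lemma codiag_oplus n m (f g : L n m) :
  codiag m \oc oplus f g = copairing kC f g.
Proof.
rewrite copairing_comp !mcompA copairing_kap1 copairing_kap2.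
by rewrite !mcomp_idl.
Qed.

Lemma haddE n m (f g : L n m) : hadd f g = copairing kC f g \oc diag n.
Proof. by rewrite /hadd codiag_oplus. Qed.

Lemma copairing_eq n m p (f g : L (n + m)%N p) :
  f \oc kap1 kC n m = g \oc kap1 kC n m ->
  f \oc kap2 kC n m = g \oc kap2 kC n m -> f = g.
Proof.
by move=> e1 e2; rewrite -(copairing_eta kC f) e1 e2 copairing_eta.
Qed.

Lemma pairing_eq n m p (f g : L p (n + m)%N) :
  prj1 pC n m \oc f = prj1 pC n m \oc g ->
  prj2 pC n m \oc f = prj2 pC n m \oc g -> f = g.
Proof.
by move=> e1 e2; rewrite -(pairing_eta pC f) e1 e2 pairing_eta.
Qed.

Lemma oplus_diag n m (f g : L n m) : oplus f g \oc diag n = pairing pC f g.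
Proof.
have [b11 b22 b21 b12] := smb_biprod L.
have e1 : prj1 pC m m \oc oplus f g = f \oc prj1 pC n n.
  apply: copairing_eq; rewrite -!mcompA ?copairing_kap1 ?copairing_kap2 ?b11 ?b12.
    by rewrite mcompA b11 mcomp_idl mcomp_idr.
  by rewrite mcompA b12 -/(hzero _ _) hzero_compl hzero_compr.
have e2 : prj2 pC m m \oc oplus f g = g \oc prj2 pC n n.
  apply: copairing_eq; rewrite -!mcompA ?copairing_kap1 ?copairing_kap2 ?b21 ?b22.
    by rewrite mcompA b21 -/(hzero _ _) hzero_compl hzero_compr.
  by rewrite mcompA b22 mcomp_idl mcomp_idr.
apply: pairing_eq; rewrite mcompA (e1, e2) -mcompA.
  by rewrite !prj1_pairing mcomp_idr.
by rewrite !prj2_pairing mcomp_idr.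
Qed.

Lemma haddE' n m (f g : L n m) : hadd f g = codiag m \oc pairing pC f g.
Proof. by rewrite /hadd -mcompA oplus_diag. Qed.

Lemma hadd_interchange n m (a b c d : L n m) :
  hadd (hadd a b) (hadd c d) = hadd (hadd a c) (hadd b d).
Proof.
rewrite haddE' (haddE a b) (haddE c d) -pairing_comp.
have -> : pairing pC (copairing kC a b) (copairing kC c d)
        = copairing kC (pairing pC a c) (pairing pC b d).
  apply: pairing_eq; rewrite copairing_comp ?prj1_pairing ?prj2_pairing //.
by rewrite mcompA copairing_comp -!haddE' -haddE.
Qed.

Lemma haddf0 n m (f : L n m) : hadd f (hzero n m) = f.
Proof.
have [b11 b22 b21 b12] := smb_biprod L.
rewrite haddE.
have -> : copairing kC f (hzero n m) = f \oc prj1 pC n n.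
  apply: copairing_eq; rewrite -mcompA ?copairing_kap1 ?copairing_kap2.
    by rewrite b11 mcomp_idr.
  by rewrite b12 -/(hzero _ _) hzero_compr.
by rewrite -mcompA prj1_pairing mcomp_idr.
Qed.

Lemma hadd0f n m (f : L n m) : hadd (hzero n m) f = f.
Proof.
have [b11 b22 b21 b12] := smb_biprod L.
rewrite haddE.
have -> : copairing kC (hzero n m) f = f \oc prj2 pC n n.
  apply: copairing_eq; rewrite -mcompA ?copairing_kap1 ?copairing_kap2.
    by rewrite b21 -/(hzero _ _) hzero_compr.
  by rewrite b22 mcomp_idr.
by rewrite -mcompA prj2_pairing mcomp_idr.
Qed.

Lemma haddC n m : commutative (@hadd n m).
Proof.
move=> f g.
by rewrite -{1}(hadd0f f) -{1}(haddf0 g) hadd_interchange hadd0f haddf0.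
Qed.

Lemma haddA n m : associative (@hadd n m).
Proof. by move=> f g h; rewrite -{1}(haddf0 f) hadd_interchange hadd0f. Qed.

Lemma hcompDl n m p (f g : L m p) (h : L n m) :
  hadd f g \oc h = hadd (f \oc h) (g \oc h).
Proof. by rewrite haddE' -mcompA pairing_comp -haddE'. Qed.

Lemma hcompDr n m p (h : L m p) (f g : L n m) :
  h \oc hadd f g = hadd (h \oc f) (h \oc g).
Proof. by rewrite haddE mcompA copairing_comp -haddE. Qed.

Lemma law_rho1 : rho mC 1 = idm 1.
Proof.
rewrite -(strict_rho (smb_mon_strict L)) -(iomap_id (law_inc L)).
by congr (law_inc L _ _ _); apply/funext => i; rewrite /= !ord1.
Qed.

Lemma law_lam1 : lam mC 1 = idm 1.
Proof.
rewrite -(strict_lam (smb_mon_strict L)) -(iomap_id (law_inc L)).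
by congr (law_inc L _ _ _); apply/funext => i; rewrite /= !ord1.
Qed.

Lemma tens_scalarl (f : L 1 1) : tens mC f (idm 1) = f.
Proof.
by have := rho_nat mC f; rewrite law_rho1 [LHS]mcomp_idl [RHS]mcomp_idr.
Qed.

Lemma tens_scalarr (f : L 1 1) : tens mC (idm 1) f = f.
Proof.
by have := lam_nat mC f; rewrite law_lam1 [LHS]mcomp_idl [RHS]mcomp_idr.
Qed.

Lemma hcompC (f g : L 1 1) : f \oc g = g \oc f.
Proof.
have e1 := tens_comp mC f (idm 1) (idm 1) g.
have e2 := tens_comp mC (idm 1) f g (idm 1).
rewrite !(mcomp_idl, mcomp_idr, tens_scalarl, tens_scalarr) in e1 e2.
exact: etrans (esym e1) e2.
Qed.

Definition scalars : Type := L 1 1.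

(* Classical choice supplies the [eqType] and [choiceType] structures that the
   semiring interface requires. *)
HB.instance Definition _ := gen_eqMixin scalars.
HB.instance Definition _ := gen_choiceMixin scalars.
HB.instance Definition _ := GRing.isNmodule.Build scalars
  (@haddA 1 1) (@haddC 1 1) (@hadd0f 1 1).
HB.instance Definition _ := GRing.Nmodule_isComPzSemiRing.Build scalars
  (fun f g h : L 1 1 => mcompA f g h) (hcompC : commutative (@mcomp _ L 1 1 1))
  (fun f : L 1 1 => mcomp_idl f)
  (fun f g h : L 1 1 => hcompDl f g h) (fun f : L 1 1 => hzero_compl _ f).

End Scalars.

Section ScalarsMap.
Variables (L K : smbLaw) (F : smbHom L K).

Lemma smb_fun_copairing n m p (f : L n p) (g : L m p) :
  F _ _ (copairing (law_coprod L) f g)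
  = copairing (law_coprod K) (F _ _ f) (F _ _ g).
Proof.
have [F1 F2] := smb_fun_coprod F.
apply: copairing_eq; rewrite -(F1, F2) -iomap_comp.
  by rewrite F1 !copairing_kap1.
by rewrite F2 !copairing_kap2.
Qed.

Lemma smb_fun_pairing n m p (f : L p n) (g : L p m) :
  F _ _ (pairing (smb_prod L) f g)
  = pairing (smb_prod K) (F _ _ f) (F _ _ g).
Proof.
have [F1 F2] := smb_fun_prod F.
apply: pairing_eq; rewrite -(F1, F2) -iomap_comp.
  by rewrite F1 !prj1_pairing.
by rewrite F2 !prj2_pairing.
Qed.

Lemma smb_fun_hzero n m : F _ _ (hzero L n m) = hzero K n m.
Proof.
rewrite /hzero /zeromap iomap_comp; congr (_ \oc _).
  exact: from0_eta.
exact: to0_eta.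
Qed.

Lemma smb_fun_hadd n m (f g : L n m) :
  F _ _ (hadd f g) = hadd (F _ _ f) (F _ _ g).
Proof.
by rewrite !haddE iomap_comp smb_fun_copairing smb_fun_pairing !iomap_id.
Qed.

Definition scalars_map (s : scalars L) : scalars K := F 1 1 s.

HB.instance Definition _ :=
  GRing.isNmodMorphism.Build (scalars L) (scalars K) scalars_map
    (conj (smb_fun_hzero 1 1) (@smb_fun_hadd 1 1)).
HB.instance Definition _ :=
  GRing.isMonoidMorphism.Build (scalars L) (scalars K) scalars_map
    (conj (iomap_id F 1) (fun f g : L 1 1 => iomap_comp F f g)).

End ScalarsMap.

Definition calH : functor SMBLaw CSRng.
Proof.
apply: (@Functor SMBLaw CSRng
  (fun L => scalars L : comPzSemiRingType)
  (fun L K F => scalars_map F : {rmorphism scalars L -> scalars K})).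
- by move=> L; apply: rmorphismP.
- by move=> L K M G F; apply: rmorphismP.
Defined.

Definition scalars_star (L : dsmbLaw) (s : scalars L) : scalars L :=
  @dag L 1 1 s.

(* Main.v *)
(* In a biproduct dagger theory L every f : n -> m is determined by its
   coefficients in the semiring L(1, 1), namely e_j^dagger o f o e_i where the
   unit vectors e_i : 1 -> n come from aleph0.  Coefficients of composites,
   tensors, daggers and images of aleph0 are given by the matrix formulas, so a
   map of involutive semirings S -> L(1, 1), applied entrywise, extends uniquely
   to a map Mat(S) -> L. *)
Require Import Defs.
From HB Require Import structures.
From mathcomp Require Import all_boot all_order all_algebra.
From mathcomp Require Import boolp.

Set Implicit Arguments.
Unset Strict Implicit.
Unset Printing Implicit Defensive.

Import GRing.Theory.
Local Open Scope ring_scope.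

(** * The dagger exchanges coproduct and product structure *)

Section Coefficients.
Variable L : dsmbLaw.
Local Notation kC := (law_coprod L).
Local Notation pC := (smb_prod L).
Local Notation mC := (smb_mon L).
Local Notation dagL := (dag_dagger L).

Lemma dagM n m p (g : L m p) (f : L n m) : dag (g \oc f) = dag f \oc dag g.
Proof. exact: (dag_comp dagL). Qed.

Lemma dag_involutive n m (f : L n m) : dag (dag f) = f.
Proof. exact: (dagK dagL). Qed.

Lemma dag_kap1 n m : dag (kap1 kC n m) = prj1 pC n m.
Proof. by rewrite (dag_prj1 dagL) dag_involutive. Qed.

Lemma dag_kap2 n m : dag (kap2 kC n m) = prj2 pC n m.
Proof. by rewrite (dag_prj2 dagL) dag_involutive. Qed.

Lemma dag_copairing n m p (f : L n p) (g : L m p) :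
  dag (copairing kC f g) = pairing pC (dag f) (dag g).
Proof.
apply: pairing_eq; rewrite -(dag_kap1, dag_kap2) -dagM.
  by rewrite copairing_kap1 dag_kap1 prj1_pairing.
by rewrite copairing_kap2 dag_kap2 prj2_pairing.
Qed.

Lemma dag_hzero n m : dag (hzero L n m) = hzero L m n.
Proof.
rewrite /hzero /zeromap dagM; congr (_ \oc _).
  exact: from0_eta.
exact: to0_eta.
Qed.

(** The two formulas for the sum, [haddE] and [haddE'], are dagger-dual: cotuples become tuples and
    the diagonal becomes the codiagonal. *)
Lemma dag_hadd n m (f g : L n m) : dag (hadd f g) = hadd (dag f) (dag g).
Proof.
rewrite haddE haddE' dagM dag_copairing; congr (_ \oc _).
rewrite -[RHS]dag_involutive; congr dag.
by rewrite dag_copairing !(dag_id dagL).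
Qed.

(** * Unit vectors: orthonormality and resolution of the identity *)

Definition unitv n (i : 'I_n) : L 1%N n := law_inc L 1%N n (fun _ => i).

Lemma law_inc_unitv n m (g : 'I_n -> 'I_m) (i : 'I_n) :
  law_inc L n m g \oc unitv i = unitv (g i).
Proof. by rewrite /unitv -iomap_comp. Qed.

Lemma law_inc_kap1 n m : law_inc L _ _ (@lshift n m) = kap1 kC n m.
Proof. by case: (law_inc_coprod L). Qed.

Lemma law_inc_kap2 n m : law_inc L _ _ (@rshift n m) = kap2 kC n m.
Proof. by case: (law_inc_coprod L). Qed.

Lemma unitv_lshift n m (i : 'I_n) : unitv (lshift m i) = kap1 kC n m \oc unitv i.
Proof. by rewrite -law_inc_kap1 law_inc_unitv. Qed.

Lemma unitv_rshift n m (i : 'I_m) : unitv (rshift n i) = kap2 kC n m \oc unitv i.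
Proof. by rewrite -law_inc_kap2 law_inc_unitv. Qed.

Lemma unitv1 (i : 'I_1) : unitv i = idm 1%N.
Proof.
rewrite -(iomap_id (law_inc L)); congr (law_inc L _ _ _).
by apply/funext => j; rewrite !ord1.
Qed.

(** Induction on [n], splitting off one summand: the four cases are the four biproduct equations,
    since the dagger turns coprojections into projections. *)
Lemma dag_unitv n (i j : 'I_n) :
  dag (unitv j) \oc unitv i = (i == j)%:R :> scalars L.
Proof.
have [b11 b22 b21 b12] := smb_biprod L.
elim: n i j => [[]//|n IH]; rewrite -add1n => i j.
have ordE (k : 'I_(1 + n)) : k = lshift n (ord0 : 'I_1) \/ exists k', k = rshift 1 k'.
  rewrite -(splitK k); case: split => k'; [left|right; by exists k'].
  by rewrite (ord1 k').
case: (ordE i) => [|[i']] ->; case: (ordE j) => [|[j']] ->;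
  rewrite ?unitv_lshift ?unitv_rshift ?unitv1 ?mcomp_idr ?dagM ?dag_kap1 ?dag_kap2.
- by rewrite b11 eqxx.
- by rewrite -mcompA b21 -/(hzero L _ _) hzero_compr.
- by rewrite mcompA b12 -/(hzero L _ _) hzero_compl.
- rewrite mcompA -[X in X \oc _]mcompA b22 mcomp_idr IH.
  by rewrite (inj_eq (@rshift_inj 1 n)).
Qed.

Lemma biproduct_id n m :
  hadd (kap1 kC n m \oc prj1 pC n m) (kap2 kC n m \oc prj2 pC n m)
  = idm (n + m)%N.
Proof.
have [b11 b22 b21 b12] := smb_biprod L.
apply: copairing_eq; rewrite hcompDl -!mcompA ?b11 ?b12 ?b21 ?b22;
  by rewrite -?/(hzero L _ _) hzero_compr mcomp_idr mcomp_idl ?haddf0 ?hadd0f.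
Qed.

(** Inserts the identity of [n], decomposed by [biproduct_id] one summand at a time; for [n = 0] the
    composite factors through the zero object, so it is the empty sum. *)
Lemma comp_unitv n (v : L n 1%N) (u : L 1%N n) :
  v \oc u = \sum_(j < n) ((v \oc unitv j) \oc (dag (unitv j) \oc u) : scalars L).
Proof.
elim: n v u => [|n IH] v u.
  by rewrite big_ord0 (to0_eta pC u) (from0_eta kC v).
move: v u; rewrite -add1n => v u; rewrite big_split_ord big_ord1 /=.
rewrite -[v in LHS]mcomp_idr -biproduct_id hcompDr hcompDl.
apply: (congr2 (@hadd L 1 1)).
  by rewrite unitv_lshift unitv1 mcomp_idr dag_kap1 !mcompA.
rewrite mcompA -mcompA IH; apply: eq_bigr => j _.
by rewrite unitv_rshift dagM dag_kap2 !mcompA.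
Qed.

(** * Coefficients and the matrix formulas *)

Definition coeff n m (f : L n m) (i : 'I_n) (j : 'I_m) : scalars L :=
  dag (unitv j) \oc f \oc unitv i.

Lemma unitv_epi n p (f g : L n p) :
  (forall i, f \oc unitv i = g \oc unitv i) -> f = g.
Proof.
elim: n f g => [|n IH] f g; first by rewrite (from0_eta kC f) (from0_eta kC g).
move: f g; rewrite -add1n => f g fg; apply: copairing_eq.
  by have := fg (lshift n ord0); rewrite unitv_lshift unitv1 mcomp_idr.
by apply: IH => i; have := fg (rshift 1 i); rewrite unitv_rshift !mcompA.
Qed.

(** The dagger image of [unitv_epi]. *)
Lemma unitv_mono n p (f g : L p n) :
  (forall j, dag (unitv j) \oc f = dag (unitv j) \oc g) -> f = g.
Proof.
move=> fg; rewrite -(dag_involutive f) -(dag_involutive g); congr dag.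
apply: unitv_epi => i.
by rewrite -(dag_involutive (unitv i)) -!dagM fg.
Qed.

Lemma coeff_inj n m (f g : L n m) :
  (forall i j, coeff f i j = coeff g i j) -> f = g.
Proof.
move=> fg; apply: unitv_epi => i; apply: unitv_mono => j.
by rewrite !mcompA; exact: fg.
Qed.

Lemma coeff_comp n m p (g : L m p) (f : L n m) i k :
  coeff (g \oc f) i k = \sum_j coeff f i j * coeff g j k.
Proof.
rewrite /coeff mcompA -mcompA comp_unitv; apply: eq_bigr => j _.
(* Multiplication of scalars is composition, which lists the factors in the opposite order to the
   matrix formula. *)
by rewrite [RHS]mulrC /GRing.mul /= !mcompA.
Qed.

Lemma coeff_dag n m (f : L n m) i j :
  coeff (dag f) i j = scalars_star (coeff f j i).
Proof. by rewrite /coeff /scalars_star !dagM dag_involutive mcompA. Qed.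

Lemma coeff_law_inc n m (g : 'I_n -> 'I_m) i j :
  coeff (law_inc L n m g) i j = (g i == j)%:R.
Proof. by rewrite /coeff -mcompA law_inc_unitv dag_unitv. Qed.

Lemma coeff_scalar (s : scalars L) i j : coeff (s : L 1 1) i j = s.
Proof. by rewrite /coeff !unitv1 (dag_id dagL) mcomp_idl mcomp_idr. Qed.

(** In [aleph0] the tensor of two constant functions is by computation the constant function at
    [coV (i, j)], and [1 * 1] reduces to [1]. *)
Lemma unitv_tens n m (i : 'I_n) (j : 'I_m) :
  unitv (coV (i, j)) = tens mC (unitv i) (unitv j).
Proof.
pose f : aleph0 1%N n := fun _ => i; pose g : aleph0 1%N m := fun _ => j.
exact: (strict_tens (smb_mon_strict L) f g).
Qed.

Lemma dag_unitv_tens n m (i : 'I_n) (j : 'I_m) :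
  dag (unitv (coV (i, j))) = tens mC (dag (unitv i)) (dag (unitv j)).
Proof. by rewrite unitv_tens; exact: (dag_tens dagL (unitv i) (unitv j)). Qed.

(** Eckmann-Hilton: interchange applied to [s] after the identity and the identity after [t]. *)
Lemma tens_scalars (s t : L 1%N 1%N) : tens mC s t = s \oc t.
Proof.
rewrite -{1}[s]mcomp_idr -{1}[t]mcomp_idl tens_comp.
by rewrite tens_scalarl tens_scalarr.
Qed.

Lemma coeff_tens n m p q (f : L n m) (g : L p q) c d :
  coeff (tens mC f g) c d
  = coeff f (co c).1 (co d).1 * coeff g (co c).2 (co d).2.
Proof.
rewrite -{1}(coK c) -{1}(coK d).
case: (co c) (co d) => [i k] [j l] /=.
rewrite /coeff dag_unitv_tens unitv_tens; apply: esym.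
by apply: etrans (esym (tens_scalars _ _)) _; rewrite !tens_comp.
Qed.

(** * Morphisms with prescribed coefficients *)

Fixpoint cotuple n p : ('I_n -> L 1%N p) -> L n p :=
  match n with
  | 0 => fun _ => from0 kC p
  | n'.+1 => fun v => copairing kC (v (lshift n' (ord0 : 'I_1)))
                                   (cotuple (fun i => v (rshift 1 i)))
  end.

Lemma cotupleS n p (v : 'I_(1 + n) -> L 1%N p) :
  cotuple v = copairing kC (v (lshift n ord0)) (cotuple (fun i => v (rshift 1 i))).
Proof. by []. Qed.

Lemma cotuple_unitv n p (v : 'I_n -> L 1%N p) i : cotuple v \oc unitv i = v i.
Proof.
elim: n v i => [|n IH]; first by move=> v [].
rewrite -add1n => v i; rewrite cotupleS -(splitK i).
case: split => k; rewrite /unsplit.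
  by rewrite (ord1 k) unitv_lshift unitv1 mcomp_idr copairing_kap1.
by rewrite unitv_rshift mcompA copairing_kap2 IH.
Qed.

(** The inner tuple into [m] is the dagger of a cotuple; the scalars are daggered first so that the
    outer dagger restores them. *)
Definition of_coeffs n m (a : 'I_n -> 'I_m -> scalars L) : L n m :=
  cotuple (fun i => dag (cotuple (fun j => dag (a i j : L 1%N 1%N)))).

Lemma coeff_of_coeffs n m (a : 'I_n -> 'I_m -> scalars L) i j :
  coeff (of_coeffs a) i j = a i j.
Proof.
by rewrite /coeff -mcompA cotuple_unitv -dagM cotuple_unitv dag_involutive.
Qed.

Lemma scalars_involution : is_involution (@scalars_star L).
Proof.
split=> [s t||s t||s].
- exact: dag_hadd.
- exact: dag_hzero.
(* The dagger reverses composition; commutativity of scalars makes it multiplicative. *)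
- by rewrite mulrC; exact: dagM.
- exact: (dag_id dagL).
- exact: dag_involutive.
Qed.

End Coefficients.

(** A unit vector is an iterated composite of coprojections, and [F] preserves these strictly. *)
Lemma dsmb_fun_unitv (L K : dsmbLaw) (F : dsmbHom L K) n (i : 'I_n) :
  F _ _ (unitv L i) = unitv K i.
Proof.
have [F1 F2] := smb_fun_coprod F.
elim: n i => [[]//|n IH]; rewrite -add1n => i; rewrite -(splitK i).
case: split => k; rewrite /unsplit.
  by rewrite !unitv_lshift !unitv1 !mcomp_idr F1.
by rewrite !unitv_rshift iomap_comp F2 IH.
Qed.

Lemma dsmb_fun_coeff (L K : dsmbLaw) (F : dsmbHom L K) n m (f : L n m) i j :
  coeff (F _ _ f) i j = scalars_map F (coeff f i j).
Proof.
by rewrite /coeff /scalars_map !iomap_comp dsmb_fun_dag !dsmb_fun_unitv.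
Qed.

(** * Conjugate transpose as a dagger on matrices *)

Section MatDagger.
Variable S : icsRing.
Local Notation inv := (star_involution S).

Lemma star_nat n : star (n%:R : S) = n%:R.
Proof.
by elim: n => [|n IH]; rewrite ?(star0 inv) // !mulrS (starD inv) (star1 inv) IH.
Qed.

Lemma star_sum (I : Type) (r : seq I) (F : I -> S) :
  star (\sum_(i <- r) F i) = \sum_(i <- r) star (F i).
Proof.
by elim/big_rec2: _ => [|i y x _ <-]; rewrite ?(star0 inv) ?(starD inv).
Qed.

(** The entries 0 and 1 are fixed by [star], and the transpose of a permutation matrix is its
    inverse. *)
Lemma mat_dag_fun n m (g : 'I_n -> 'I_m) (h : 'I_m -> 'I_n) :
  cancel g h -> cancel h g -> mat_dag (mat_fun S g) = mat_fun S h.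
Proof.
move=> gK hK; apply/matrixP => i j.
by rewrite !mxE star_nat eq_sym -(can2_eq hK gK).
Qed.

Lemma mat_dag_iso n m (g : 'I_n -> 'I_m) (h : 'I_m -> 'I_n) :
  cancel g h -> cancel h g ->
  @is_dagger_iso (mat_law S) (@mat_dag S) n m (mat_fun S g).
Proof.
move=> gK hK; rewrite /is_dagger_iso (mat_dag_fun gK hK).
by split; rewrite /= -mat_fun_comp -mat_fun_id; congr mat_fun; apply/funext.
Qed.

Lemma mat_dagger : is_dagger (@mat_dag S).
Proof.
split.
- by move=> n; apply/matrixP => i j; rewrite !mxE star_nat eq_sym.
- move=> n m p g f; apply/matrixP => i j; rewrite !mxE star_sum.
  by apply: eq_bigr => k _; rewrite !mxE (starM inv) mulrC.
- by move=> n m f; apply/matrixP => i j; rewrite !mxE (starK inv).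
- by move=> n m p q f g; apply/matrixP => c d; rewrite !mxE (starM inv).
- by move=> n m p; apply: mat_dag_iso; [exact: falphaK|exact: falphaVK].
- by move=> n; apply: mat_dag_iso; [exact: frhoK|exact: frhoVK].
- by move=> n m; apply: mat_dag_iso; exact: fgamK.
- move=> n m; rewrite /= /mat_dag /mat_prj1 trmxK; apply/matrixP => i j.
  (* Reading the zero block as [0%:R] lets [star_nat] cover both blocks. *)
  by rewrite !mxE; case: split => k; rewrite mxE -?[0]/(0%:R) star_nat.
- move=> n m; rewrite /= /mat_dag /mat_prj2 trmxK; apply/matrixP => i j.
  by rewrite !mxE; case: split => k; rewrite mxE -?[0]/(0%:R) star_nat.
Qed.

Definition mat_dsmb : dsmbLaw := DsmbLaw mat_dagger.

Lemma mat_hadd n m (A B : mat_law S n m) : hadd A B = A + B.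
Proof. by rewrite haddE /= mul_row_col !mul1mx. Qed.

Lemma mat_coeff n m (A : mat_dsmb n m) i j :
  coeff A i j = (A i j)%:M :> 'M[S]_1.
Proof.
apply/matrixP => k l; rewrite !ord1 /coeff /= mul_mat_fun !mxE eqxx.
rewrite (bigD1 j) //= !mxE eqxx star_nat mulr1 big1 ?addr0 // => k' kj.
by rewrite !mxE star_nat eq_sym (negPf kj) mulr0.
Qed.

End MatDagger.

Lemma mat_hom_dag (S T : icsRing) (f : icsHom S T) n m (A : mat_law S n m) :
  mat_hom f _ _ (mat_dag A) = mat_dag (mat_hom f _ _ A).
Proof. by apply/matrixP => i j; rewrite !mxE ics_fun_star. Qed.

Definition MatI : functor ICSRng DSMBLaw.
Proof.
apply: (@Functor ICSRng DSMBLaw mat_dsmb (fun S T f =>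
  @DsmbHom (mat_dsmb S) (mat_dsmb T) (mat_hom f) (mat_hom_dag f))).
- by move=> S; apply: dsmbHomP => n m A; apply/matrixP => i j; rewrite mxE.
- by move=> S T U g f; apply: dsmbHomP => n m A; apply/matrixP => i j; rewrite !mxE.
Defined.

(** * The restricted scalar functor *)

Definition scalars_ics (L : dsmbLaw) : icsRing := IcsRing (scalars_involution L).

Lemma scalars_map_star (L K : dsmbLaw) (F : dsmbHom L K) (s : scalars L) :
  scalars_map F (scalars_star s) = scalars_star (scalars_map F s).
Proof. exact: dsmb_fun_dag. Qed.

Definition HD : functor DSMBLaw ICSRng.
Proof.
apply: (@Functor DSMBLaw ICSRng scalars_ics (fun L K F =>
  @IcsHom (scalars_ics L) (scalars_ics K)
    (scalars_map F : {rmorphism scalars L -> scalars K}) (scalars_map_star F))).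
- by move=> L; apply: icsHomP.
- by move=> L K M G F; apply: icsHomP.
Defined.

(** * The bijection between homsets *)

Section Adjunction.
Variables (S : icsRing) (L : dsmbLaw).

Section Adjunct.
Variable F : dsmbHom (mat_dsmb S) L.

Definition mat_scalar (s : S) : scalars L := F 1%N 1%N (s%:M : 'M_1).

Lemma mat_scalar_nmod : nmod_morphism mat_scalar.
Proof.
split; rewrite /mat_scalar.
  rewrite (_ : 0%:M = hzero (mat_dsmb S) 1%N 1%N); first exact: smb_fun_hzero.
  by rewrite raddf0 /hzero /zeromap /= mul0mx.
move=> s t; rewrite raddfD /= -mat_hadd; exact: smb_fun_hadd.
Qed.

Lemma mat_scalar_monoid : monoid_morphism mat_scalar.
Proof.
split; first exact: (iomap_id F).
(* Composition in [mat_cat] is the matrix product with its factors reversed. *)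
move=> s t; rewrite /mat_scalar mulrC scalar_mxM.
exact: (@iomap_comp _ _ _ F 1%N 1%N 1%N).
Qed.

HB.instance Definition _ :=
  GRing.isNmodMorphism.Build S (scalars L) mat_scalar mat_scalar_nmod.
HB.instance Definition _ :=
  GRing.isMonoidMorphism.Build S (scalars L) mat_scalar mat_scalar_monoid.

Lemma mat_scalar_star s : mat_scalar (star s) = scalars_star (mat_scalar s).
Proof.
rewrite /mat_scalar /scalars_star -dsmb_fun_dag; congr (F _ _ _).
by apply/matrixP => i j; rewrite !mxE !ord1.
Qed.

Definition adjunct : icsHom S (scalars_ics L) :=
  @IcsHom S (scalars_ics L) (mat_scalar : {rmorphism S -> scalars L})
    mat_scalar_star.
End Adjunct.

Section Extension.
Variable f : icsHom S (scalars_ics L).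

Definition extend n m (A : mat_dsmb S n m) : L n m :=
  of_coeffs (fun i j => f (A i j) : scalars L).

Lemma coeff_extend n m (A : mat_dsmb S n m) i j :
  coeff (extend A) i j = f (A i j).
Proof. exact: coeff_of_coeffs. Qed.

(** Coprojections and coherence isomorphisms are images of functions on both sides, so their strict
    preservation reduces to this equation. *)
Lemma extend_fun n m (g : 'I_n -> 'I_m) :
  extend (mat_fun S g) = law_inc L n m g.
Proof.
by apply: coeff_inj => i j; rewrite coeff_extend coeff_law_inc mxE rmorph_nat.
Qed.

Lemma extend_id n : extend (idm n) = idm n.
Proof. by rewrite /= -mat_fun_id extend_fun; exact: (iomap_id (law_inc L)). Qed.

Lemma extend_comp n m p (B : mat_dsmb S m p) (A : mat_dsmb S n m) :
  extend (B \oc A) = extend B \oc extend A.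
Proof.
apply: coeff_inj => i k; rewrite coeff_extend coeff_comp mxE rmorph_sum.
by apply: eq_bigr => j _; rewrite !coeff_extend rmorphM.
Qed.

Definition extend_io : ioFunctor (mat_dsmb S) L :=
  @IoFunctor _ (mat_dsmb S) L extend extend_id extend_comp.

Lemma extend_dag n m (A : mat_dsmb S n m) : extend (dag A) = dag (extend A).
Proof.
apply: coeff_inj => i j.
by rewrite coeff_extend coeff_dag coeff_extend !mxE ics_fun_star.
Qed.

Lemma extend_coprod :
  strict_coproducts (law_coprod (mat_dsmb S)) (law_coprod L) extend_io.
Proof.
have [c1 c2] := law_inc_coprod (mat_dsmb S).
by split=> n m; rewrite -(law_inc_kap1 L, law_inc_kap2 L) -(c1, c2); exact: extend_fun.
Qed.

Lemma extend_prod :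
  strict_products (smb_prod (mat_dsmb S)) (smb_prod L) extend_io.
Proof.
have [c1 c2] := extend_coprod.
(* Projections are daggers of coprojections, which are already preserved. *)
split=> n m; rewrite -!(dag_kap1, dag_kap2) [LHS]extend_dag; congr dag.
  exact: c1.
exact: c2.
Qed.

Lemma extend_mon : strict_symmon (smb_mon (mat_dsmb S)) (smb_mon L) extend_io.
Proof.
split; first 1 last.
- by move=> n m p; rewrite -(strict_alpha (smb_mon_strict L)); exact: extend_fun.
- by move=> n; rewrite -(strict_lam (smb_mon_strict L)); exact: extend_fun.
- by move=> n; rewrite -(strict_rho (smb_mon_strict L)); exact: extend_fun.
- by move=> n m; rewrite -(strict_gam (smb_mon_strict L)); exact: extend_fun.
move=> n m p q A B; apply: coeff_inj => c d.
by rewrite coeff_tens !coeff_extend mxE rmorphM.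
Qed.

Definition extend_dsmb : dsmbHom (mat_dsmb S) L :=
  @DsmbHom (mat_dsmb S) L
    (@SmbHom (mat_law S) L extend_io extend_coprod extend_prod extend_mon)
    extend_dag.
End Extension.

(** [F] sends coefficients to coefficients, and those of a matrix are its entries as 1-by-1
    matrices, on which [F] acts as [adjunct F]. *)
Lemma adjunctK : cancel adjunct extend_dsmb.
Proof.
move=> F; apply: dsmbHomP => n m A; apply: coeff_inj => i j.
by rewrite [LHS]coeff_extend [RHS]dsmb_fun_coeff mat_coeff.
Qed.

Lemma extendK : cancel extend_dsmb adjunct.
Proof.
move=> f; apply: icsHomP => s.
(* A scalar is its own single coefficient. *)
rewrite -[LHS](@coeff_scalar L _ ord0 ord0) [LHS]coeff_extend.
by rewrite mxE eqxx.
Qed.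
End Adjunction.

(** * Naturality and comparison with the unrestricted functors *)

Lemma MatI_HD_adjunction : adjunction MatI HD.
Proof.
exists adjunct; split=> [S L|S S' L K f h k].
  exists (@extend_dsmb S L); [exact: adjunctK|exact: extendK].
(* Both sides apply [k] and then [h] to the 1-by-1 matrix of [f s]. *)
apply: icsHomP => s /=; rewrite /mat_scalar /scalars_map /=.
by rewrite map_scalar_mx.
Qed.

Theorem lemma32 :
  exists (MatI : functor ICSRng DSMBLaw) (HD : functor DSMBLaw ICSRng),
    [/\ compF forget_dag MatI = compF Mat forget_star
          /\ (forall S : icsRing, exists ax : is_dagger (@mat_dag S),
                MatI S = @DsmbLaw (mat_law S) (@mat_dag S) ax),
        compF forget_star HD = compF calH forget_dag
          /\ (forall L : dsmbLaw, exists ax : is_involution (@scalars_star L),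
                HD L = @IcsRing (scalars L) (@scalars_star L) ax)
      & adjunction MatI HD].
Proof.
exists MatI, HD; split; last exact: MatI_HD_adjunction.
- split; last by move=> S; exists (mat_dagger S).
  (* The composites agree by computation on objects and arrows; only the proofs of functoriality
     differ. *)
  by rewrite /compF; congr Functor; exact: Prop_irrelevance.
- split; last by move=> L; exists (scalars_involution L).
  by rewrite /compF; congr Functor; exact: Prop_irrelevance.
Qed.
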